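(* Let $a<b$ be positive integers with $a$ even and $b$ odd. Then there is no infinite smooth word over $\{a,b\}$ that is also an infinite Lyndon word.
   Context: Words over $\{a,b\}$ are compared lexicographically with $a<b$. For a word $w$ over $\{a,b\}$ written as maximal blocks $\alpha_0^{i_0}\alpha_1^{i_1}\cdots$ ($\alpha_{k+1}\ne\alpha_k$, $i_k\ge1$), $\Delta(w)=i_0i_1\cdots$. An infinite word $w\in\{a,b\}^\omega$ is smooth if $\Delta^k(w)\in\{a,b\}^\omega$ for all $k\ge0$. An infinite Lyndon word is an infinite word strictly smaller than each of its proper suffixes. *)

(* Defs.v *)
From mathcomp Require Import all_boot.

Set Implicit Arguments.
Unset Strict Implicit.
Unset Printing Implicit Defensive.

Definition iword := nat -> nat.

Definition over (a b : nat) (w : iword) : Prop :=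
  forall n, w n = a \/ w n = b.

(* [is_block_decomp w alpha i] : w = alpha_0^(i_0) alpha_1^(i_1) ... with
   maximal blocks; the k-th block occupies the positions
   i_0 + ... + i_(k-1) + r, r < i_k. *)
Definition is_block_decomp (w alpha i : iword) : Prop :=
  [/\ forall k, 1 <= i k,
      forall k, alpha k.+1 <> alpha k
    & forall k r, r < i k -> w (\sum_(j < k) i j + r) = alpha k].

(* The graph of the operator Delta on infinite words.  Delta is a partial
   function into infinite words: if w is eventually constant, its last block
   has infinite length and Delta(w) is not an infinite word over nat. *)
Definition is_Delta (w d : iword) : Prop :=
  exists alpha : iword, is_block_decomp w alpha d.

Fixpoint is_Delta_iter (k : nat) (w u : iword) : Prop :=
  match k with
  | 0 => u = w
  | k'.+1 => exists2 v, is_Delta_iter k' w v & is_Delta v u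
  end.

Definition smooth (a b : nat) (w : iword) : Prop :=
  forall k, exists2 u, is_Delta_iter k w u & over a b u.

Definition lex_lt (u v : iword) : Prop :=
  exists2 n, (forall m, m < n -> u m = v m) & u n < v n.

Definition suffix_from (k : nat) (w : iword) : iword := fun n => w (k + n).

Definition infinite_Lyndon (w : iword) : Prop :=
  forall k, 0 < k -> lex_lt w (suffix_from k w).

Lemma is_Delta_unique (w d d' : iword) :
  is_Delta w d -> is_Delta w d' -> d =1 d'.
Proof.
have H (e e' al al' : iword) k : is_block_decomp w al e ->
    is_block_decomp w al' e' -> (forall j, j < k -> e j = e' j) ->
    ~~ (e k < e' k).
  move=> [e1 aln we] [e1' _ we'] Hj; apply/negP => lt_k.
  have eS : \sum_(j < k) e j = \sum_(j < k) e' j.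
    by apply: eq_bigr => j _; apply: Hj.
  have w0 : w (\sum_(j < k) e j + 0) = al k by apply: we.
  have w0' : w (\sum_(j < k) e j + 0) = al' k by rewrite eS; apply: we'.
  have w1 : w (\sum_(j < k.+1) e j + 0) = al k.+1 by apply: we.
  have w1' : w (\sum_(j < k) e j + e k) = al' k by rewrite eS; apply: we'.
  by move: w1; rewrite big_ord_recr addn0 w1' -w0' w0 => /esym; apply: aln.
move=> [al Hd] [al' Hd'] k; elim/ltn_ind: k => k IH.
case: ltngtP (H _ _ _ _ _ Hd Hd' IH) (H _ _ _ _ k Hd' Hd) => // _ _ H'.
by have := H' (fun j lt_jk => esym (IH j lt_jk)).
Qed.

(* Main.v *)
From mathcomp Require Import all_boot zify.
Require Import Defs.

Set Implicit Arguments.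
Unset Strict Implicit.
Unset Printing Implicit Defensive.

(** Let [w] be smooth and Lyndon, with iterates [d = Delta w], [e = Delta d],
    [f = Delta e], [g = Delta f].  As [a >= 2], blocks of [d] have length at
    least 2, so some [b] sits at an even index of [d], i.e. [w] contains a
    block [a^b]; minimality of [w] then forces [d] to start with [bb], so that
    [w] starts with [a^b b^b].  Hence [a^b b^a a] is not a factor of [w]: no
    block of [b]'s in [d] ends at an even index.  Since [a] is even and [b]
    odd, this means [e = a x1 x1 x2 x2 ...], so [f 0] is odd and all other
    [f k] are even, i.e. [f = b a a a ...], and [Delta f] is not an infinite
    word. *)

Lemma is_Delta_eq (w w' d : iword) : w =1 w' -> is_Delta w d -> is_Delta w' d.
Proof.
by move=> eqw [al [e1 aln we]]; exists al; split=> // k r; rewrite -eqw; apply: we.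
Qed.

(** [is_Delta] fixes its value only up to [=1], so iterates must be transported along pointwise
    equality. *)
Lemma is_Delta_iter_eq (k : nat) (w w' u : iword) :
  w =1 w' -> is_Delta_iter k w u -> exists2 u', is_Delta_iter k w' u' & u =1 u'.
Proof.
move=> eqw; elim: k u => [|k IH] u /=; first by move->; exists w'.
move=> [v /IH [v' itv' eqv] Dvu].
by exists u => //; exists v' => //; apply: is_Delta_eq Dvu.
Qed.

Lemma is_Delta_iterSl (k : nat) (w u : iword) :
  is_Delta_iter k.+1 w u -> exists2 v, is_Delta w v & is_Delta_iter k v u.
Proof.
elim: k u => [|k IH] u; first by move=> [v -> Dwu]; exists u.
move=> [v /IH [v' Dwv' itv] Dvu].
by exists v' => //; exists v.
Qed.

Lemma smooth_Delta (a b : nat) (w : iword) :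
  smooth a b w -> exists2 d, is_Delta w d & smooth a b d.
Proof.
move=> sw; have [d [_ -> Dwd] _] := sw 1; exists d => // k.
have [u /is_Delta_iterSl [v Dwv itv] ou] := sw k.+1.
have [u' itu' equ] := is_Delta_iter_eq (is_Delta_unique Dwv Dwd) itv.
by exists u' => // n; rewrite -equ; apply: ou.
Qed.

Lemma smooth_over (a b : nat) (w : iword) : smooth a b w -> over a b w.
Proof. by move=> /(_ 0) [u /= ->]. Qed.

Lemma block_alternate (a b : nat) (w al i : iword) :
    over a b w -> is_block_decomp w al i -> al 0 = a ->
  forall k, al k = if odd k then b else a.
Proof.
move=> ow [i1 aln wi] al0; elim=> [//|k IH] /=.
have := aln k; have := ow (\sum_(j < k.+1) i j + 0).
by rewrite wi // IH; case: (odd k) => -[] ->.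
Qed.

Lemma lex_ltPn (u v : iword) (n : nat) :
  (forall m, m < n -> v m <= u m) -> v n < u n -> ~ lex_lt u v.
Proof.
move=> le_vu lt_vu [m eq_uv lt_uv]; case: (ltngtP m n) => [lt|lt|eq_mn].
- by have := le_vu m lt; lia.
- by have := eq_uv n lt; lia.
- by move: lt_uv; rewrite eq_mn; lia.
Qed.

Lemma not_Delta_eventually_const (c : nat) (u d : iword) :
  (forall k, u k.+1 = c) -> ~ is_Delta u d.
Proof.
move=> uc [al [d1 aln ud]].
have al_c k : al k.+1 = c.
  by rewrite -(ud k.+1 0) // addn0 big_ord_recl -(prednK (d1 _)) addSn uc.
by apply: (aln 1); rewrite !al_c.
Qed.

Section SmoothLyndon.

Variables (a b : nat).
Hypotheses (a_gt0 : 0 < a) (a_lt_b : a < b) (a_even : ~~ odd a) (b_odd : odd b).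

Lemma over_odd (u : iword) (k : nat) : over a b u -> u k = if odd (u k) then b else a.
Proof. by move=> /(_ k) [] ->; rewrite ?b_odd ?(negbTE a_even). Qed.

Lemma over_ge2 (u : iword) (k : nat) : over a b u -> 1 < u k.
Proof. by move=> /(_ k) [] ->; lia. Qed.

(** Otherwise the suffix from the second block on would start with the smaller letter. *)
Lemma Lyndon_block_start (w al d : iword) :
  over a b w -> infinite_Lyndon w -> is_block_decomp w al d -> al 0 = a.
Proof.
move=> ow Lw [d1 aln wd].
have w0 : w 0 = al 0 by rewrite -(wd 0 0) // big_ord0.
have w1 : w (d 0) = al 1 by rewrite -(wd 1 0) // addn0 big_ord1.
have [] := ow 0; rewrite w0 // => al0.
have [] := ow (d 0); rewrite w1 => al1; last by case: (aln 0); rewrite al1.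
case: (lex_ltPn (n := 0) _ _ (Lw _ (d1 0))) => //.
by rewrite /suffix_from addn0 w0 w1 al0 al1.
Qed.

(* An even index [p] of [d] is where a block of [a]'s starts in [w], and there
   a longer block makes the suffix smaller. *)
Lemma Lyndon_Delta_start (w d : iword) (p : nat) :
    over a b w -> infinite_Lyndon w -> is_Delta w d -> over a b d ->
  ~~ odd p -> d p = b -> d 0 = b.
Proof.
move=> ow Lw [al Dw] od p_even dp.
have al_alt := block_alternate ow Dw (Lyndon_block_start ow Lw Dw).
have [d1 _ wd] := Dw.
have [d0|//] := od 0.
have p_gt0 : 0 < p by case: p dp {p_even} => //; lia.
have S_gt0 : 0 < \sum_(j < p) d j.
  by rewrite -(prednK p_gt0) big_ord_recl; have := d1 0; rewrite /=; lia.
have sw r : r < b -> suffix_from (\sum_(j < p) d j) w r = a.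
  by move=> ltr; rewrite /suffix_from wd ?dp // al_alt (negbTE p_even).
(* If [d 0 = a], the first [b] of [w] is at index [a], where the suffix, starting with [b] copies of
   [a], still has an [a]. *)
case: (lex_ltPn (n := a) _ _ (Lw _ S_gt0)) => [m ltm|].
  by rewrite sw; [have [] := ow m; lia | lia].
by rewrite sw // -[X in w X]addn0 -{2}d0 -(big_ord1 addn (fun j => d j)) wd // al_alt.
Qed.

(** Otherwise a suffix starts with $a^b b^a a$ and beats the prefix $a^b b^b$ of [w] at index
    [b + a]. *)
Lemma Lyndon_Delta_bb (w d : iword) (p : nat) :
    over a b w -> infinite_Lyndon w -> is_Delta w d ->
    d 0 = b -> d 1 = b -> ~~ odd p -> d p = b -> d p.+1 <> a.
Proof.
move=> ow Lw [al Dw] d0 d1b p_even dp dp1.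
have al_alt := block_alternate ow Dw (Lyndon_block_start ow Lw Dw).
have [d1 _ wd] := Dw.
have p_gt0 : 0 < p by case: p dp1 {p_even dp} => //; lia.
have S_gt0 : 0 < \sum_(j < p) d j.
  by rewrite -(prednK p_gt0) big_ord_recl; have := d1 0; rewrite /=; lia.
set S := \sum_(j < p) d j in S_gt0 *.
have s0 r : r < b -> w (S + r) = a.
  by move=> ltr; rewrite wd ?dp // al_alt (negbTE p_even).
have s2 : w (S + (b + a)) = a.
  have := wd p.+2 0 (d1 _).
  by rewrite !big_ord_recr /= dp dp1 addn0 -addnA al_alt /= (negbTE p_even).
have w1 r : r < b -> w (b + r) = b.
  move=> ltr; have := wd 1 r; rewrite big_ord1 d0 d1b al_alt; exact.
case: (lex_ltPn (n := b + a) _ _ (Lw _ S_gt0)) => [m ltm|].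
- rewrite /suffix_from; have [ltb|leb] := ltnP m b.
    by rewrite s0 //; have [] := ow m; lia.
  rewrite -[X in _ <= w X](subnKC leb) w1; last by lia.
  by have [] := ow (S + m); lia.
- by rewrite /suffix_from s2 w1.
Qed.

(** The sum is the index in [d] just after a block of [b]'s; were it odd, that block would end at an
    even index and be followed by [a]. *)
Lemma Lyndon_Delta2 (w d e : iword) :
    over a b w -> infinite_Lyndon w -> is_Delta w d -> over a b d ->
    is_Delta d e -> over a b e ->
  forall m, ~~ odd (\sum_(j < m.*2.+1) e j).
Proof.
move=> ow Lw Dwd od [be Dde] oe.
have [e1 ben de] := Dde.
have [p p_even dp] : exists2 p, ~~ odd p & d p = b.
  have [k bek] : exists k, be k = b.
    have obe k : be k = a \/ be k = b by rewrite -(de k 0) //; apply: od.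
    have := ben 0; have [] := (obe 0, obe 1) => [] [be0|be0] [be1|be1];
      by [rewrite be0 be1 | exists 0 | exists 1].
  (* A block of [b]'s starting at an odd index also covers the next, even one. *)
  have [oS|eS] := boolP (odd (\sum_(j < k) e j)).
    exists (\sum_(j < k) e j + 1); first by rewrite addn1 /= oS.
    by rewrite de //; apply: over_ge2.
  by exists (\sum_(j < k) e j + 0); [rewrite addn0 | rewrite de].
have d0 := Lyndon_Delta_start ow Lw Dwd od p_even dp.
have be0 : be 0 = b by rewrite -(de 0 0) // big_ord0.
have d1 : d 1 = b by rewrite -be0 -(de 0 1) ?big_ord0 //; apply: over_ge2.
(* The letters are swapped because [d] starts with [b]. *)
have od' : over b a d by move=> n; case: (od n); [right | left].
have be_alt := block_alternate od' Dde be0.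
move=> m; apply/negP => oS.
have SE : \sum_(j < m.*2.+1) e j = (\sum_(j < m.*2) e j + (e m.*2).-1).+1.
  by rewrite big_ord_recr /=; have := e1 m.*2; lia.
apply: (Lyndon_Delta_bb ow Lw Dwd d0 d1 _ _) (_ : d _ = a).
- by move: oS; rewrite SE /=; exact.
- rewrite de; last by have := e1 m.*2; lia.
  by rewrite be_alt odd_double.
- by rewrite -SE -[X in d X]addn0 de // be_alt /= odd_double.
Qed.

(** A block of [e] starting at a positive even index would separate two letters that [e_pair] shows
    equal: their sum is even, and parity determines the letter. *)
Lemma even_prefix_Delta_odd (e f : iword) :
    over a b e -> (forall m, ~~ odd (\sum_(j < m.*2.+1) e j)) ->
    is_Delta e f ->
  forall k, odd (\sum_(j < k.+1) f j).
Proof.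
move=> oe e_even [ga [f1 gan ef]] k; apply/negPn/negP => Sk_even.
have e_pair m : e m.*2.+1 = e m.*2.+2.
  have := e_even m; have := e_even m.+1.
  rewrite doubleS 2!(big_ord_recr _.+1) /= !oddD => /[swap] /negbTE -> /=.
  rewrite (over_odd m.*2.+1 oe) (over_odd m.*2.+2 oe).
  by case: (odd (e m.*2.+1)); case: (odd (e m.*2.+2)); rewrite ?b_odd ?(negbTE a_even).
have Sk_gt0 : 0 < \sum_(j < k.+1) f j by rewrite big_ord_recr /=; have := f1 k; lia.
have [m SkE] : exists m, \sum_(j < k.+1) f j = m.*2.+2.
  by exists (\sum_(j < k.+1) f j)./2.-1; lia.
apply: (gan k).
rewrite -(ef k.+1 0) // addn0 SkE -e_pair -(ef k (f k).-1); last by have := f1 k; lia.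
by congr (e _); move: SkE; rewrite big_ord_recr /=; have := f1 k; lia.
Qed.

End SmoothLyndon.

Theorem theorem15 (a b : nat) (a_gt0 : 0 < a) (a_lt_b : a < b)
  (a_even : ~~ odd a) (b_odd : odd b) :
  ~ exists w : iword, smooth a b w /\ infinite_Lyndon w.
Proof.
move=> [w [sw Lw]].
have [d Dwd sd] := smooth_Delta sw; have [e Dde se] := smooth_Delta sd.
have [f Def sf] := smooth_Delta se; have [g Dfg _] := smooth_Delta sf.
have ow := smooth_over sw; have od := smooth_over sd.
have oe := smooth_over se; have of_ := smooth_over sf.
have e_even := Lyndon_Delta2 a_gt0 a_lt_b a_even b_odd ow Lw Dwd od Dde oe.
have f_odd := even_prefix_Delta_odd a_gt0 a_lt_b a_even b_odd oe e_even Def.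
apply: (not_Delta_eventually_const (c := a) _ Dfg) => k.
(* Two consecutive odd prefix sums differ by an even letter. *)
have := f_odd k.+1; rewrite big_ord_recr /= oddD f_odd => /negbTE fk_even.
by rewrite (over_odd a_even b_odd k.+1 of_) fk_even.
Qed.
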